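(* Let $P$ be an EL-shellable finite bounded graded poset of rank $3$. If $P$ is rank-uniform, then there is an EL-labeling $\lambda$ of $P$ such that $(P,\lambda)$ is a rank-uniform EL-labeled poset.
   Context: Let $P$ be a finite graded bounded poset with rank function $\mathrm{rk}$, minimum $\hat 0$ and maximum $\hat 1$. Write $s\lessdot t$ if $t$ covers $s$, and let $\mathcal{E}(P)$ be the set of pairs $(s,t)$ with $s\lessdot t$. Rank-uniform poset (no labeling): for $s\in P$ and $k\ge 0$, $W_k(s)$ is the number of elements of rank $k+\mathrm{rk}(s)$ that are above $s$ (i.e. $\geqslant s$). $P$ is rank-uniform if $W_k(s)=W_k(t)$ for all $s,t\in P$ of the same rank and all positive integers $k$. An edge labeling is a map $\lambda:\mathcal{E}(P)\to\Lambda$, where $\Lambda$ is a totally ordered set (order $\vartriangleleft$). A maximal chain $s=u_0\lessdot u_1\lessdot\cdots\lessdot u_k=t$ of the interval $[s,t]$ has label word $\lambda(u_0,u_1)\cdots\lambda(u_{k-1},u_k)$. EL-labeling: $\lambda$ is an EL-labeling if for all $s\leqslant t$ in $P$ there is a unique maximal chain of $[s,t]$ whose label word is weakly increasing (as the rank increases), and this chain's label word is lexicographically minimal among the label words of all maximal chains of $[s,t]$. $P$ is EL-shellable if it admits an EL-labeling. An EL-labeled poset is a pair $(P,\lambda)$ with $\lambda$ an EL-labeling. For an EL-labeled poset $(P,\lambda)$ and $s\in P$, let $\lambda_1\vartriangleleft\cdots\vartriangleleft\lambda_\ell$ be the distinct labels of the covering relations $s\lessdot t$ above $s$. - Width: $\omega_s(i)=|\{t: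 s\lessdot t,\ \lambda(s,t)=\lambda_i\}|$ for $1\le i\le\ell$, and $\omega_s(i)=0$ for $i>\ell$. - Index: for $s\lessdot t$, $\mathrm{Ind}(s,t)$ is the unique $i\in[\ell]$ with $\lambda_i=\lambda(s,t)$. - Descents: for $s\lessdot t$, if $\lambda'_1\vartriangleleft\cdots\vartriangleleft\lambda'_{\ell'}$ are the distinct labels of the covering relations above $t$, then $\mathrm{des}_s(t)=|\{j\in[\ell']:\lambda'_j\vartriangleleft\lambda(s,t)\}|$. Rank-uniform (EL-)labeled poset: an EL-labeled poset $(P,\lambda)$ such that (uniform width) $\omega_s(i)=\omega_{s'}(i)$ for all $s,s'$ of the same rank and all $i\ge1$, and (uniform descent) $\mathrm{des}_s(t)=\mathrm{des}_{s'}(t')$ whenever $s,s'$ have the same rank, $s\lessdot t$, $s'\lessdot t'$ and $\mathrm{Ind}(s,t)=\mathrm{Ind}(s',t')$. *)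

(* Defs.v *)
From mathcomp Require Export all_boot all_order.

Set Implicit Arguments.
Unset Strict Implicit.
Unset Printing Implicit Defensive.

Import Order.TTheory.
Local Open Scope order_scope.

Definition covers d (P : finTBPOrderType d) (s t : P) : bool :=
  (s < t) && [forall u : P, ~~ ((s < u) && (u < t))].

(* On a finite bounded poset this determines [rk], and such an [rk] exists iff
   the poset is graded. *)
Definition rank_function d (P : finTBPOrderType d) (rk : P -> nat) : Prop :=
  rk \bot = 0%N /\ forall s t : P, covers s t -> rk t = (rk s).+1.

Definition whitney d (P : finTBPOrderType d) (rk : P -> nat) (s : P)
    (k : nat) : nat :=
  #|[set t : P | (s <= t) && (rk t == k + rk s)%N]|.

Definition rank_uniform d (P : finTBPOrderType d) (rk : P -> nat) : Prop :=
  forall (s t : P) (k : nat),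
    rk s = rk t -> (0 < k)%N -> whitney rk s k = whitney rk t k.

(* The maximal chain u_0, ..., u_k of [s, t] is encoded by its tail
   [:: u_1; ...; u_k], as for [path]. *)
Definition maxchain d (P : finTBPOrderType d) (s t : P) (c : seq P) : bool :=
  path (@covers d P) s c && (last s c == t).

(* An edge labeling is a function [lam : P -> P -> L] of which only the values
   on covering pairs are ever used. *)

Definition label_word d (P : finTBPOrderType d) dL (L : orderType dL)
    (lam : P -> P -> L) (s : P) (c : seq P) : seq L :=
  pairmap lam s c.

(* [seqlexi L] is [seq L] with the lexicographic order. *)
Definition EL_labeling d (P : finTBPOrderType d) dL (L : orderType dL)
    (lam : P -> P -> L) : Prop :=
  forall s t : P, s <= t ->
    exists c : seq P,
      [/\ maxchain s t c,
          sorted <=%O (label_word lam s c),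
          forall c', maxchain s t c' -> sorted <=%O (label_word lam s c') ->
            c' = c
        & forall c', maxchain s t c' ->
            (label_word lam s c : seqlexi L) <= (label_word lam s c' : seqlexi L)].

Definition EL_shellable d (P : finTBPOrderType d) : Prop :=
  exists (dL : Order.disp_t) (L : orderType dL) (lam : P -> P -> L),
    EL_labeling lam.

Definition labels_above d (P : finTBPOrderType d) dL (L : orderType dL)
    (lam : P -> P -> L) (s : P) : seq L :=
  sort <=%O (undup [seq lam s t | t <- enum P & covers s t]).

(* Indices start at 1 in [width] and [Ind]; [onth] returns [None] past the end
   of the list, so the width is 0 there. *)
Definition width d (P : finTBPOrderType d) dL (L : orderType dL)
    (lam : P -> P -> L) (s : P) (i : nat) : nat :=
  #|[set t : P | covers s t && (onth (labels_above lam s) i.-1 == Some (lam s t))]|.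

Definition Ind d (P : finTBPOrderType d) dL (L : orderType dL)
    (lam : P -> P -> L) (s t : P) : nat :=
  (index (lam s t) (labels_above lam s)).+1.

Definition des d (P : finTBPOrderType d) dL (L : orderType dL)
    (lam : P -> P -> L) (s t : P) : nat :=
  count (fun l => l < lam s t) (labels_above lam t).

Definition uniform_width d (P : finTBPOrderType d) (rk : P -> nat)
    dL (L : orderType dL) (lam : P -> P -> L) : Prop :=
  forall (s s' : P) (i : nat),
    rk s = rk s' -> (1 <= i)%N -> width lam s i = width lam s' i.

Definition uniform_descent d (P : finTBPOrderType d) (rk : P -> nat)
    dL (L : orderType dL) (lam : P -> P -> L) : Prop :=
  forall s s' t t' : P,
    rk s = rk s' -> covers s t -> covers s' t' ->
    Ind lam s t = Ind lam s' t' -> des lam s t = des lam s' t'.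

Definition rank_uniform_EL_labeled d (P : finTBPOrderType d) (rk : P -> nat)
    dL (L : orderType dL) (lam : P -> P -> L) : Prop :=
  [/\ EL_labeling lam, uniform_width rk lam & uniform_descent rk lam].

(* Main.v *)
Require Import Defs.
From mathcomp Require Import all_boot all_order.
From mathcomp Require Import zify.

(** Only the bipartite graph of atoms and coatoms matters in rank three, and
    rank-uniformity says that all atoms have the same number of coatoms above
    them.  An EL-labeling forces this graph to be traversable: let [a0] be the
    atom on the increasing maximal chain of [P].  If [a] is any other atom, let
    [a < c < \top] be the increasing chain of [[a, \top]].  As [a0] is not [a],
    the chain [\bot < a < c < \top] is not increasing, hence its descent is at
    [a], and the increasing chain of [[\bot, c]] then passes through an atom with
    a strictly smaller label.  Refining the labels [lam \bot _] to a linear order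
    [pos] gives an order of the atoms that starts at [a0] and in which every
    other atom [a] has a coatom [f a] above it that also lies above an earlier
    atom ([EL_atom_order]).

    Conversely, such an order alone yields an EL-labeling [rank3_label] with
    values in [nat].  Chains from an atom [a] to [\top] rise only through [f a],
    because all labels below [\top] and the label of [(a, f a)] are [0], while the
    other labels above [a] are positive.  Chains from [\bot] to a coatom [c]
    should rise only through the earliest atom below [c]; so the label of [(a, c)]
    is made larger than all labels of atoms when [a] is the earliest atom below
    [c], and smaller than that of [a] otherwise.  The two requirements conflict
    at [(a, f a)] only if [a] is the earliest atom below [f a], which happens for
    [a = a0] alone, and the atom [a0] gets the label [0] to reconcile them.

    Labels are pairwise distinct above each element, so widths are [0] or [1] and
    depend only on the number of covers, which is a Whitney number
    ([uniform_width_inj]).  Descents are uniform because an edge above an atom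
    has a descent exactly when its label is nonzero, that is, when its index is
    not the first one. *)

Set Implicit Arguments.
Unset Strict Implicit.
Unset Printing Implicit Defensive.

Import Order.TTheory.
Local Open Scope order_scope.

(** * Orderings of finite types and sorted sequences *)

(** The refinement is the index in the list of all elements sorted along [g];
    ties of [g] are broken by the sorting. *)
Lemma linear_refinement (T : finType) dL (L : orderType dL) (g : T -> L) :
  exists pos : T -> nat,
    [/\ injective pos, forall x, (pos x < #|T|)%N
      & forall x y, g x < g y -> (pos x < pos y)%N].
Proof.
pose r := sort (relpre g <=%O) (enum T).
have mem_r x : x \in r by rewrite mem_sort mem_enum.
exists (index^~ r); split.
- by move=> x y; apply: (index_inj x).
- by move=> x; rewrite cardT -(size_sort (relpre g <=%O)) index_mem.
- move=> x y lt_xy; rewrite ltnNge; apply/negP; rewrite leq_eqVlt.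
  have r_sorted : sorted (relpre g <=%O) r.
    by apply: sort_sorted => u v; apply: le_total.
  have g_trans : transitive (relpre g <=%O) by move=> u v w; apply: le_trans.
  case/orP=> [/eqP eq_yx|lt_yx].
    by move: lt_xy; rewrite (index_inj x _ _ eq_yx) // ltxx.
  have /= := sorted_ltn_index g_trans r_sorted y x (mem_r y) (mem_r x) lt_yx.
  by rewrite leNgt lt_xy.
Qed.

Lemma index_sorted_nat0 (r : seq nat) (x : nat) :
  sorted <=%O r -> 0%N \in r -> (index x r == 0%N) = (x == 0%N).
Proof.
case: r => [//|y r] /=; rewrite path_sortedE; last exact: le_trans.
case/andP=> /allP le_y _; rewrite inE => r0.
have -> : y = 0%N.
  by case/predU1P: r0 => // /le_y; rewrite leEnat leqn0 => /eqP.
by case: x.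
Qed.

(** * Ranks and maximal chains *)

Section Rank.
Variables (d : Order.disp_t) (P : finTBPOrderType d) (rk : P -> nat).
Hypothesis rkP : rank_function rk.
Implicit Types s t : P.

(** A cover of [s] below [t] is an element of [(s, t]] with fewest elements
    below it. *)
Lemma le_maxchain s t : s <= t -> exists c, maxchain s t c.
Proof.
have [n] := ubnP #|[set u | s < u <= t]|; elim: n s => // n IHn s.
have [->|ne_st] := eqVneq s t.
  by exists [::]; rewrite /maxchain /= eqxx.
move=> le_n le_st; have lt_st : s < t by rewrite lt_neqAle ne_st.
have Pt : s < t <= t by rewrite lt_st lexx.
case: (@arg_minnP _ t [pred u | s < u <= t] (fun u => #|[set v | v < u]|) Pt).
move=> u /= /andP[lt_su le_ut] min_u.
have su : covers s u.
  rewrite /covers lt_su; apply/forallP=> v; apply/negP=> /andP[lt_sv lt_vu].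
  have := min_u v; rewrite lt_sv (le_trans (ltW lt_vu)) // => /(_ isT).
  rewrite leqNgt => /negP; apply; apply/proper_card/properP; split.
    by apply/subsetP=> w; rewrite !inE => /lt_trans; apply.
  by exists v; rewrite !inE ?ltxx.
have [] := IHn u _ le_ut.
  rewrite -ltnS; apply: leq_trans le_n; rewrite ltnS.
  apply/proper_card/properP; split.
    apply/subsetP=> w; rewrite !inE => /andP[lt_uw ->].
    by rewrite (lt_trans lt_su).
  by exists u; rewrite !inE ?lt_su ?ltxx.
by move=> c; rewrite /maxchain => uc; exists (u :: c); rewrite /= su.
Qed.

Lemma rank_maxchain s t c : maxchain s t c -> rk t = (rk s + size c)%N.
Proof.
elim: c s => [|u c IHc] s; rewrite /maxchain /=.
  by move/eqP->; rewrite addn0.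
by rewrite -andbA => /andP[/(proj2 rkP) su /IHc->]; rewrite su addSnnS.
Qed.

(** Gradedness turns the cover relation into a condition on ranks, since all
    maximal chains of an interval have the same length. *)
Lemma coversE s t : covers s t = (s <= t) && (rk t == (rk s).+1).
Proof.
apply/idP/andP=> [st|[/le_maxchain[c sct] /eqP]].
  by rewrite (proj2 rkP _ _ st); case/andP: st => /ltW.
rewrite (rank_maxchain sct) -addn1 => /addnI.
move: sct; rewrite /maxchain; case: c => [|u []] //=.
by rewrite andbT => /andP[su /eqP<-].
Qed.

Lemma le_rank_eq s t : s <= t -> rk s = rk t -> s = t.
Proof.
case/le_maxchain=> c sct; rewrite (rank_maxchain sct) -[LHS]addn0 => /addnI.
by move: sct; case: c => // /andP[_ /eqP].
Qed.

Lemma le_rank s t : s <= t -> (rk s <= rk t)%N.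
Proof. by case/le_maxchain=> c /rank_maxchain->; apply: leq_addr. Qed.

Lemma rank0_bot s : (rk s == 0%N) = (s == \bot).
Proof.
apply/eqP/eqP=> [s0|->]; last exact: (proj1 rkP).
by apply/esym/le_rank_eq; rewrite ?le0x // (proj1 rkP).
Qed.

Lemma covers_bot s : covers \bot s = (rk s == 1%N).
Proof. by rewrite coversE le0x (proj1 rkP). Qed.

Lemma whitney1 s : whitney rk s 1 = #|[set t | covers s t]|.
Proof. by apply: eq_card => t; rewrite !inE coversE add1n. Qed.

(** * Labelings that are injective above each element *)

(** All widths are at most [1], so the labels only matter through their number. *)
Lemma width_inj dL (L : orderType dL) (lam : P -> P -> L) s i :
  {in covers s &, injective (lam s)} ->
  width lam s i = (i.-1 < whitney rk s 1)%N.
Proof.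
move=> lam_inj; rewrite whitney1 /width /labels_above.
set r0 := filter _ _.
have mem_r0 t : (t \in r0) = covers s t by rewrite mem_filter mem_enum andbT.
have uniq_r0 : uniq r0 by rewrite filter_uniq ?enum_uniq.
have uniq_lr0 : uniq (map (lam s) r0).
  by rewrite map_inj_in_uniq // => t u; rewrite !mem_r0; apply: lam_inj.
rewrite undup_id //; set r := sort _ _.
have uniq_r : uniq r by rewrite sort_uniq.
have size_r : size r = #|[set t | covers s t]|.
  rewrite size_sort size_map cardE; apply/perm_size/uniq_perm => //.
    exact: enum_uniq.
  by move=> t; rewrite mem_r0 mem_enum inE.
have [lt_i|le_i] := ltnP.
  have [t0 _] : exists t0, t0 \in r0.
    case: r0 @r uniq_r size_r lt_i {mem_r0 uniq_r0 uniq_lr0} => [|t r1] /= _ <- //.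
    by exists t; rewrite inE eqxx.
  have lt_ir : (i.-1 < size r)%N by rewrite size_r.
  (* By injectivity, only the cover carrying the label number [i] counts. *)
  have := mem_nth (lam s t0) lt_ir; rewrite mem_sort => /mapP[t].
  rewrite mem_r0 => st def_t; apply/eqP/cards1P; exists t; apply/setP=> u.
  rewrite !inE (onthE r) (nth_map (lam s t0)) // def_t.
  apply/andP/eqP=> [[su /eqP[]] /lam_inj->|->] //.
apply/eqP; rewrite cards_eq0; apply/eqP/setP=> u; rewrite !inE.
by rewrite (onthE r) nth_default ?andbF // size_map size_r.
Qed.

Lemma uniform_width_inj dL (L : orderType dL) (lam : P -> P -> L) :
  rank_uniform rk -> (forall s, {in covers s &, injective (lam s)}) ->
  uniform_width rk lam.
Proof.
by move=> unif lam_inj s s' i rk_s _; rewrite !width_inj // (unif s s').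
Qed.

Lemma mem_labels_above dL (L : orderType dL) (lam : P -> P -> L) s t :
  covers s t -> lam s t \in labels_above lam s.
Proof.
move=> st; rewrite mem_sort mem_undup; apply: map_f.
by rewrite mem_filter st mem_enum.
Qed.

End Rank.

Lemma EL_labeling_unique_rise d (P : finTBPOrderType d) dL (L : orderType dL)
    (lam : P -> P -> L) :
  (forall s t : P, s <= t -> exists c,
    [/\ maxchain s t c, sorted <=%O (label_word lam s c)
      & forall c', maxchain s t c' -> c' != c ->
          ~~ sorted <=%O (label_word lam s c') /\
          (label_word lam s c : seqlexi L) <= (label_word lam s c' : seqlexi L)]) ->
  EL_labeling lam.
Proof.
move=> rise s t /rise[c [sct c_sorted c_best]]; exists c; split=> // c' sc't.
  by have [//|/(c_best _ sc't)[/negP]] := eqVneq c' c.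
by have [-> //|/(c_best _ sc't)[]] := eqVneq c' c.
Qed.

(** * Extracting an order of the atoms from an EL-labeling *)

Section RankThree.
Variables (d : Order.disp_t) (P : finTBPOrderType d) (rk : P -> nat).
Hypotheses (rkP : rank_function rk) (rk3 : rk \top = 3).
Implicit Types s t a : P.

Let rk_bot : rk \bot = 0%N. Proof. by case: rkP. Qed.

Lemma covers_top s : covers s \top = (rk s == 2).
Proof. by rewrite (coversE rkP) lex1 rk3 eqSS eq_sym. Qed.

Lemma rank3_top s : rk s = 3 -> s = \top.
Proof. by move=> s3; apply: (le_rank_eq rkP); rewrite ?lex1 ?rk3. Qed.

Lemma rank_below_coatom a c : rk c = 2 -> covers a c -> rk a = 1%N.
Proof. by move=> c2 ac; apply/eqP; rewrite -eqSS -(proj2 rkP _ _ ac) c2. Qed.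

Lemma rank3_maxchain a c :
  rk a = 1%N -> covers a c -> maxchain \bot \top [:: a; c; \top].
Proof.
move=> a1 ac; rewrite /maxchain /= (covers_bot rkP) a1 ac covers_top.
by rewrite (proj2 rkP _ _ ac) a1 !eqxx.
Qed.

(** The hypothesis is used on three intervals: [[\bot, \top]] provides [a0],
    [[a, \top]] provides [f a], and [[\bot, f a]] provides the earlier atom. *)
Lemma EL_atom_order dL (L : orderType dL) (lam : P -> P -> L) :
  EL_labeling lam ->
  exists (pos : P -> nat) (a0 : P) (f : P -> P),
    [/\ injective pos /\ (forall x, (pos x < #|P|)%N), rk a0 = 1%N,
        forall a, rk a = 1%N -> covers a (f a)
      & forall a, rk a = 1%N -> a != a0 ->
          exists2 a', covers a' (f a) & (pos a' < pos a)%N].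
Proof.
move=> ELlam; have [pos [pos_inj pos_lt pos_lam]] := linear_refinement (lam \bot).
have [c0 [mc0 _ uniq_c0 _]] := ELlam _ _ (le0x (\top : P)).
have size_c0 := rank_maxchain rkP mc0; rewrite rk3 rk_bot in size_c0.
case: c0 mc0 uniq_c0 size_c0 => [|a0 [|b0 [|e0 []]]] // mc0 uniq_c0 _.
have a0_1 : rk a0 = 1%N.
  by apply/eqP; rewrite -(covers_bot rkP); case/andP: mc0 => /andP[].
have exf a : exists c, rk a = 1%N ->
    covers a c /\ (a != a0 -> exists2 a', covers a' c & (pos a' < pos a)%N).
  have [a1|/eqP a1] := eqVneq (rk a) 1%N; last by exists \bot.
  have [c1 [mc1 inc_c1 _ _]] := ELlam _ _ (lex1 a).
  have := rank_maxchain rkP mc1; rewrite rk3 a1 add1n => -[].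
  case: c1 mc1 inc_c1 => [|c [|e []]] // mc1 inc_c1 _.
  have [ac e_top] : covers a c /\ e = \top.
    by case/andP: mc1 => /andP[-> _] /eqP.
  subst e; clear mc1.
  exists c => _; split=> // ne_a; move: inc_c1; rewrite /= andbT => inc_c1.
  have bot_ac : maxchain \bot c [:: a; c].
    by rewrite /maxchain /= (covers_bot rkP) a1 ac !eqxx.
  (* Otherwise [\bot < a < c < \top] is a second increasing maximal chain. *)
  have desc : lam a c < lam \bot a.
    rewrite ltNge; apply/negP=> inc_a.
    have := uniq_c0 _ (rank3_maxchain a1 ac); rewrite /= inc_a inc_c1 => /(_ isT)[eq_a].
    by rewrite eq_a eqxx in ne_a.
  have [c2 [mc2 inc_c2 _ lex_c2]] := ELlam _ _ (le0x c).
  have := rank_maxchain rkP mc2; rewrite (rank_maxchain rkP bot_ac) rk_bot => -[].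
  case: c2 mc2 inc_c2 lex_c2 => [|a' [|e []]] // /andP[/and3P[_ a'c _] /eqP/= e_c].
  rewrite {}e_c in a'c * => inc_c2 /(_ _ bot_ac) lex_c2 _.
  exists a' => //; apply: pos_lam; move: inc_c2 lex_c2; rewrite /= andbT => inc_c2.
  (* Lexicographic minimality only gives [lam \bot a' <= lam \bot a]; equality
     would force [lam \bot a = lam \bot a' <= lam a' c <= lam a c]. *)
  rewrite lexi_cons lexi_cons; case/andP; rewrite le_eqVlt => /predU1P[eq_a|//].
  rewrite eq_a lexx /= => /andP[le_a' _].
  by have := le_lt_trans (le_trans inc_c2 le_a') desc; rewrite eq_a ltxx.
have [f fP] := fin_all_exists exf; exists pos, a0, f; split=> // a a1.
  by case: (fP a a1).
by case: (fP a a1).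
Qed.

(** * The labeling defined by an order of the atoms *)

Section Label.
Variables (pos : P -> nat) (a0 : P) (f : P -> P).
Hypotheses (pos_inj : injective pos) (pos_lt : forall x, (pos x < #|P|)%N).
Hypotheses (a0_1 : rk a0 = 1%N) (fP : forall a, rk a = 1%N -> covers a (f a)).
Hypothesis f_old : forall a, rk a = 1%N -> a != a0 ->
  exists2 a', covers a' (f a) & (pos a' < pos a)%N.

Definition first_below (a c : P) := [forall a', covers a' c ==> (pos a <= pos a')%N].

(** With [N = #|P|], the labels above atoms are [0], or in [[1, N]], or above
    [2N]; those of the atoms other than [a0] lie in between, in [[N+1, 2N]].  The
    term [enum_rank t] serves only to make labels distinct.  The value at
    [t = f s] is meaningful for an atom [s]; edges from coatoms fall under
    [t = \top]. *)
Definition rank3_label (s t : P) : nat :=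
  if s == \bot then (if t == a0 then 0 else (#|P| + pos t).+1)%N
  else if (t == \top) || (t == f s) then 0%N
  else if first_below s t then (#|P|.*2 + enum_rank t).+1%N
  else (enum_rank t).+1.

Let lam := rank3_label.

(** Every atom other than [a0] has an earlier one, so a descent along [pos]
    among atoms can only stop at [a0]. *)
Lemma pos_a0 a : rk a = 1%N -> (pos a0 <= pos a)%N.
Proof.
have [n] := ubnP (pos a); elim: n a => // n IHn a le_n a1.
have [-> //|ne_a] := eqVneq a a0; have [a' a'c lt_a'] := f_old a1 ne_a.
apply: leq_trans (ltnW lt_a'); apply: IHn; first by apply: leq_trans lt_a' _.
by apply: rank_below_coatom a'c; rewrite (proj2 rkP _ _ (fP a1)) a1.
Qed.

Lemma label_bot a : lam \bot a = if a == a0 then 0%N else (#|P| + pos a).+1.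
Proof. by rewrite /lam /rank3_label eqxx. Qed.

Lemma label_top c : rk c = 2 -> lam c \top = 0%N.
Proof.
by move=> c2; rewrite /lam /rank3_label -(rank0_bot rkP) c2 eqxx.
Qed.

Lemma label_atom a c : rk a = 1%N -> covers a c ->
  lam a c = if c == f a then 0%N
            else if first_below a c then (#|P|.*2 + enum_rank c).+1%N
            else (enum_rank c).+1.
Proof.
move=> a1 ac; rewrite /lam /rank3_label -(rank0_bot rkP) a1.
have -> // : (c == \top) = false.
by apply/eqP=> cT; have := proj2 rkP _ _ ac; rewrite cT a1 rk3.
Qed.

Lemma enum_rank_lt t : (enum_rank t < #|P|)%N.
Proof. exact: ltn_ord. Qed.

Lemma label_inj s : {in covers s &, injective (lam s)}.
Proof.
move=> t t'; rewrite -!topredE /= => st st'.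
have rk_t := proj2 rkP _ _ st; have rk_t' := proj2 rkP _ _ st'.
have := le_rank rkP (lex1 t); rewrite rk3 rk_t.
case rk_s: (rk s) => [|[|[|n]]] // _; rewrite rk_s in rk_t rk_t'.
- have -> : s = \bot by apply/eqP; rewrite -(rank0_bot rkP) rk_s.
  rewrite !label_bot; have [->|_] := eqVneq t a0; have [->|_] := eqVneq t' a0 => //.
  by case=> /addnI/pos_inj.
- rewrite !label_atom //; have lt_t := enum_rank_lt t; have lt_t' := enum_rank_lt t'.
  have [->|_] := eqVneq t (f s); have [->|_] := eqVneq t' (f s) => //.
  1-2: by case: ifP.
  by do 2 case: ifP => _; move=> eq_l; apply/enum_rank_inj/ord_inj; lia.
- by rewrite (rank3_top rk_t) (rank3_top rk_t').
Qed.

Lemma label_labels_coatom c : rk c = 2 -> labels_above lam c = [:: 0%N].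
Proof.
move=> c2; rewrite /labels_above.
have -> : [seq t <- enum P | covers c t] = [:: \top].
  rewrite -(@filter_pred1_uniq _ (enum P) \top) ?enum_uniq ?mem_enum //.
  apply: eq_filter => t /=; apply/idP/eqP=> [ct|->].
    by rewrite (rank3_top (s := t)) // (proj2 rkP _ _ ct) c2.
  by rewrite covers_top c2.
by rewrite /= label_top.
Qed.

(** Above [\bot] the index determines the atom; above an atom it determines
    whether the label is [0], the only label above a coatom; above a coatom
    there is a single edge. *)
Lemma label_uniform_descent : uniform_descent rk lam.
Proof.
move=> s s' t t' rk_ss' st s't' [eq_ind].
have rk_t := proj2 rkP _ _ st; have rk_t' := proj2 rkP _ _ s't'.
have := le_rank rkP (lex1 t); rewrite rk3 rk_t.
case rk_s: (rk s) => [|[|[|n]]] // _.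
- have def_s : s = \bot by apply/eqP; rewrite -(rank0_bot rkP) rk_s.
  have def_s' : s' = \bot by apply/eqP; rewrite -(rank0_bot rkP) -rk_ss' rk_s.
  subst s s'; suff -> : t = t' by [].
  by apply/(label_inj st s't')/(index_inj 0%N _ _ eq_ind); apply: mem_labels_above.
- have zero a c : rk a = 1%N -> covers a c ->
      (index (lam a c) (labels_above lam a) == 0%N) = (lam a c == 0%N).
    move=> a1 ac; apply: index_sorted_nat0; first exact/sort_sorted/le_total.
    have -> : 0%N = lam a (f a) by rewrite (label_atom a1 (fP a1)) eqxx.
    exact/mem_labels_above/fP.
  rewrite rk_s in rk_ss' rk_t; rewrite -rk_ss' in rk_t'.
  rewrite /des !label_labels_coatom //= !ltEnat /= !lt0n.
  by rewrite -!zero // eq_ind.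
- rewrite rk_s in rk_ss' rk_t; rewrite -rk_ss' in rk_t'.
  by rewrite (rank3_top rk_t) (rank3_top rk_t') /des !label_top.
Qed.

(** The rising chain goes through the earliest atom below [c]; it is the
    lexicographically first one since the labels of atoms increase with [pos]. *)
Lemma label_rise_below_coatom c : rk c = 2 ->
  exists a, [/\ covers a c, (lam \bot a <= lam a c)%N
    & forall a', covers a' c -> a' != a ->
        (lam a' c < lam \bot a')%N && (lam \bot a < lam \bot a')%N].
Proof.
move=> c2; have [w wc] : exists w, covers w c.
  have [r mr] := le_maxchain (le0x c); have := rank_maxchain rkP mr.
  rewrite c2 rk_bot; case: r mr => [|w [|e []]] // /andP[/and3P[_ wc _] /eqP/= <-] _.
  by exists w.
case: (@arg_minnP _ w [pred a | covers a c] pos wc) => a /= ac min_a.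
have rk1 a' : covers a' c -> rk a' = 1%N by apply: rank_below_coatom.
exists a; split=> // [|a' a'c ne_a'].
  rewrite label_bot; case: eqVneq => // ne_a; rewrite label_atom ?rk1 //.
  case: eqVneq => [def_c|_].
    (* [c = f a] lies above an atom earlier than [a]. *)
    have [a'] := f_old (rk1 _ ac) ne_a; rewrite -def_c => /min_a.
    by rewrite leqNgt => /negP.
  have -> : first_below a c by apply/forallP=> a'; apply/implyP/min_a.
  by have := pos_lt a; lia.
have lt_pos : (pos a < pos a')%N.
  by rewrite ltn_neqAle (inj_eq pos_inj) eq_sym ne_a' min_a.
have ne_a'0 : a' != a0.
  by apply: contraTneq lt_pos => ->; rewrite -leqNgt pos_a0 // rk1.
rewrite !label_bot (negPf ne_a'0) label_atom ?rk1 //.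
have -> : first_below a' c = false.
  by apply/negP=> /forallP/(_ a); rewrite ac /= leqNgt lt_pos.
have := enum_rank_lt c.
by case: (a == a0); case: (c == f a'); lia.
Qed.

(** Ranks differ by at most three, and the cases are the lengths of the interval:
    lengths zero and one leave a single chain; length two is either the interval
    from an atom to [\top], rising through [f], or the one from [\bot] to a coatom;
    length three is [P] itself, rising through [a0] and [f a0] with labels [0]. *)
Lemma label_EL : EL_labeling lam.
Proof.
apply: EL_labeling_unique_rise => s t le_st.
have rk_chain c' := @rank_maxchain _ _ _ rkP s t c'.
have := le_rank rkP (lex1 t); rewrite rk3.
have [c0 /rk_chain def_rt] := le_maxchain le_st.
have size_c' c' : maxchain s t c' -> size c' = size c0.
  by move/rk_chain; rewrite def_rt => /addnI.
case: (size c0) def_rt size_c' => [|[|[|[|n]]]]; rewrite ?addn0 => rk_t size_c'.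
- move=> _; have ts := le_rank_eq rkP le_st (esym rk_t); subst t.
  exists [::]; rewrite /maxchain /= eqxx; split=> // c' sc's.
  by have := size_c' _ sc's; case: c' {sc's}.
- move=> _; exists [:: t]; rewrite /maxchain /= (coversE rkP) le_st rk_t addn1 !eqxx.
  split=> // c' sc't; have := size_c' _ sc't; case: c' sc't => [|u []] //.
  by case/andP=> _ /eqP/= ->; rewrite eqxx.
- rewrite rk_t addn2 !ltnS leq_eqVlt ltnS leqn0 => /orP[/eqP s1|s0].
    have tT : t = \top by apply: rank3_top; rewrite rk_t s1.
    subst t; have sf := fP s1; have f2 : rk (f s) = 2 by rewrite (proj2 rkP _ _ sf) s1.
    have lam_f : lam s (f s) = 0%N by rewrite label_atom ?eqxx.
    exists [:: f s; \top]; rewrite /maxchain /= sf covers_top f2 !eqxx.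
    rewrite lam_f label_top //; split=> // c' sc't.
    have := size_c' _ sc't; case: c' sc't => [|u [|e []]] //.
    case/andP=> /and3P[su _ _] /eqP/= -> _.
    rewrite eqseq_cons eqxx andbT /= => ne_u.
    have lt_u : (0 < lam s u)%N by rewrite label_atom // (negPf ne_u); case: ifP.
    rewrite label_top ?(proj2 rkP _ _ su) ?s1 // andbT leEnat -ltnNge lt_u; split=> //.
    by rewrite lexi_cons !leEnat /= [(lam s u <= 0)%N]leqNgt lt_u.
  have def_s : s = \bot by apply/eqP; rewrite -(rank0_bot rkP).
  subst s; rewrite rk_bot in rk_t.
  have [a [ac inc_a best_a]] := label_rise_below_coatom rk_t.
  exists [:: a; t]; rewrite /maxchain /= (covers_bot rkP) (rank_below_coatom rk_t ac).
  rewrite ac !eqxx andbT leEnat inc_a.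
  split=> // c' sc't.
  have := size_c' _ sc't; case: c' sc't => [|u [|e []]] //.
  case/andP=> /and3P[_ ut _] /eqP/= e_t; rewrite {}e_t in ut *.
  rewrite eqseq_cons eqxx andbT /= => _ /(best_a _ ut)/andP[desc_u lt_u].
  rewrite andbT -ltnNge desc_u; split=> //.
  by rewrite lexi_cons !leEnat /= (ltnW lt_u) leqNgt lt_u.
- move=> rk_t3; have s0 : rk s = 0%N by lia.
  have def_s : s = \bot by apply/eqP; rewrite -(rank0_bot rkP) s0.
  subst s; have tT : t = \top by apply: rank3_top; rewrite rk_t s0.
  subst t; have a0f := fP a0_1.
  have f2 : rk (f a0) = 2 by rewrite (proj2 rkP _ _ a0f) a0_1.
  exists [:: a0; f a0; \top]; rewrite rank3_maxchain //=.
  rewrite label_bot eqxx (label_atom a0_1 a0f) eqxx label_top //; split=> // c' sc't.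
  have := size_c' _ sc't; case: c' sc't => [|a [|c [|e []]]] //.
  case/andP=> /and4P[]; rewrite (covers_bot rkP) => /eqP a1 ac _ _ /eqP/= -> _.
  rewrite label_top ?(proj2 rkP _ _ ac) ?a1 // label_bot => ne_ac.
  rewrite !lexi_cons; case: (eqVneq a a0) ne_ac ac => [->|ne_a] ne_ac ac.
    have ne_cf : c != f a0 by apply: contraNneq ne_ac => ->.
    have lt_c : (0 < lam a0 c)%N.
      by rewrite label_atom // (negPf ne_cf); case: ifP.
    rewrite /= andbT !leEnat -ltnNge lt_c; split=> //.
    by rewrite leqNgt lt_c.
  rewrite andbT negb_and -!ltnNge; split=> //.
  by have [->|_] := posnP (lam a c); rewrite ?orbT.
- by move=> rk_t3; lia.
Qed.

End Label.
End RankThree.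

Theorem theorem6p3 (d : Order.disp_t) (P : finTBPOrderType d) (rk : P -> nat)
    (rkP : rank_function rk) (rk3 : rk (\top)%O = 3)
    (ELP : EL_shellable P) (unifP : rank_uniform rk) :
  exists (dL : Order.disp_t) (L : orderType dL) (lam : P -> P -> L),
    rank_uniform_EL_labeled rk lam.
Proof.
case: ELP => dL [L [lam0 /(EL_atom_order rkP rk3)]].
case=> pos [a0 [f [[pos_inj pos_lt] a0_1 fP f_old]]].
exists _, nat, (rank3_label pos a0 f : P -> P -> nat); split.
- exact: (label_EL rkP rk3).
- exact/(uniform_width_inj rkP unifP)/(label_inj rkP rk3).
- exact: (label_uniform_descent rkP rk3).
Qed.
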